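(* Let $s\in(0,1)$ and let $F:\mathbb{R}\to\mathbb{R}$ be a smooth function such that $F(1)=F(-1)=0<F(u)$ for all $-1<u<1$, $F'(1)=F'(-1)=0$, $F$ is nondecreasing in $(-1,0)$ and nonincreasing in $(0,1)$, and $F''(0)<0$. Let $$T_0:=\inf\{T>0:\ \text{the equation } (-\partial_{xx})^su+F'(u)=0 \text{ in }\mathbb{R} \text{ has a nonconstant periodic solution with period } T\}.$$ Then $$T_0\le 2\pi\left(\frac{1}{-F''(0)}\right)^{\frac{1}{2s}}.$$
   Context: $(-\partial_{xx})^s$ is the fractional Laplacian, the Fourier multiplier with symbol $|\xi|^{2s}$; on a $T$-periodic function it multiplies the Fourier mode $e^{2\pi i m x/T}$ by $|2\pi m/T|^{2s}$. A periodic solution with period $T$ is a real-valued function $u$ with $u(x+T)=u(x)$ for all $x\in\mathbb{R}$ satisfying the equation. *)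

(* Defs.v *)
From HB Require Import structures.
From mathcomp Require Import all_boot all_order all_algebra.
From mathcomp Require Import all_classical all_reals all_analysis.
From mathcomp Require Import complex.

Set Implicit Arguments.
Unset Strict Implicit.
Unset Printing Implicit Defensive.

Import Order.TTheory GRing.Theory Num.Theory.
Import numFieldNormedType.Exports.

Local Open Scope ring_scope.
Local Open Scope classical_set_scope.

Definition smooth (R : realType) (f : R -> R) : Prop :=
  forall (n : nat) (x : R), derivable (f^`(n)) x 1.

(* T^-1 * \int_0^T u(x) e^(-2 pi i m x / T) dx, by real and imaginary parts *)
Definition fourier_coef (R : realType) (T : R) (u : R -> R) (m : int) : R[i] :=
  Complex
    (T^-1 * \int[@lebesgue_measure R]_(x in `[0, T])
              (u x * cos (2 * pi * m%:~R * x / T)))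
    (- (T^-1 * \int[@lebesgue_measure R]_(x in `[0, T])
              (u x * sin (2 * pi * m%:~R * x / T)))).

(* (-\partial_xx)^s u = g for T-periodic functions. Continuity makes g unique,
   a continuous periodic function being determined by its Fourier coefficients.
   The symbol vanishes at m = 0, since 0 `^ (2 * s) = 0 when s != 0. *)
Definition is_fractional_laplacian (R : realType) (s T : R) (u g : R -> R)
    : Prop :=
  [/\ continuous u, continuous g, periodic u T, periodic g T &
      forall m : int,
        fourier_coef T g m
        = real_complex R (`|2 * pi * m%:~R / T| `^ (2 * s))
          * fourier_coef T u m].

Definition periodic_solution (R : realType) (s : R) (F : R -> R) (T : R)
    (u : R -> R) : Prop :=
  is_fractional_laplacian s T u (fun x => - (F^`() (u x))%classic).

Definition nonconstant (R : realType) (u : R -> R) : Prop :=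
  ~ exists c : R, forall x : R, u x = c.

(* T need not be the minimal period of u. The infimum is taken in the extended
   reals, so that it is +oo, and not a junk real, if no T qualifies. *)
Definition T0 (R : realType) (s : R) (F : R -> R) : \bar R :=
  ereal_inf [set T%:E | T in [set T : R | 0 < T /\
    exists u : R -> R, nonconstant u /\ periodic_solution s F T u]].

(* Main.v *)
Require Import Defs.
From mathcomp Require Import all_boot all_order all_algebra.
From mathcomp Require Import all_classical all_reals all_analysis.
From mathcomp Require Import complex ring lra zify.

Import Order.TTheory GRing.Theory Num.Theory.
Import numFieldNormedType.Exports.

Local Open Scope ring_scope.
Local Open Scope classical_set_scope.

(** Periods just above [2 pi / lam ^ (1 / 2s)], with [lam = - F''(0)], are
realized by solutions of small amplitude that bifurcate from the equilibrium
[u = 0]. As [0] is an interior maximum of [F], [F'(0) = 0], and the reaction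
term is [- F'(z) = lam z + r(z)] where [r] is Lipschitz near [0] with a constant
as small as desired ([lipschitz_near0]). On functions of period 1, rescaled to
period [T], the fractional Laplacian multiplies the [m]-th mode by
[mu m^(2s)], with [mu = (2 pi / T)^(2s)]; at [mu = lam] the linearized equation
has, among even functions, a kernel spanned by [cos (2 pi x)].

Look for [u = a (cos (2 pi x) + v)], where [a > 0] is small and fixed, [v] is
even without first mode, and [mu = lam + nu] is an unknown too. With
[rho = r (a (cos + v)) / a], the first mode of the equation determines
[nu = 2 rho_1], and the other modes, after division by [m^(2s) - 1], become
[lam v = M rho - rho_0 - nu (v - v_0 - 2 v_1 cos + M v)],
where [M] is the Fourier multiplier with symbol [1 / (m^(2s) - 1)] on the modes
[m >= 2]. The operators in this equation do not depend on [nu], and [rho] and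
[nu] have small Lipschitz constants in [v]; so the equation is solved by the
contraction principle in the unit ball for the sup norm ([bifurcating_profile]).

In the sup norm, composition with [r] is as Lipschitz as [r] itself; what has to
be shown is that [M] is bounded on continuous functions, for every [s > 0], even
where [1 / (m^(2s) - 1)] is not summable. This comes from convexity: a convex
sequence that decreases to [0] is a combination with nonnegative coefficients of
the triangles [max (n + 1 - m, 0)], so that its multiplier is a convergent sum
of Fejer operators, which have nonnegative kernels ([convex_multiplier]); and
[1 / (m^(2s) - 1)] is convex for [m >= 2] because [m^(2s)] is log-concave
([power_symbol_multiplier]).

Finally [|nu|] is as small as desired, so [T = 2 pi / (lam + nu)^(1 / 2s)] can
be taken below any prescribed number above the bound, whence the bound on the
infimum. *)

(** * Averages over a period and cosine modes *)

Section Average.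
Context {R : realType}.
Implicit Types (f g u : R -> R) (c d x y : R) (k l m n : nat).

Lemma contD f g : continuous f -> continuous g ->
  continuous (fun x => f x + g x).
Proof. by move=> cf cg x; apply: continuousD; [exact: cf|exact: cg]. Qed.

Lemma contB f g : continuous f -> continuous g ->
  continuous (fun x => f x - g x).
Proof. by move=> cf cg x; apply: continuousB; [exact: cf|exact: cg]. Qed.

Lemma contM f g : continuous f -> continuous g ->
  continuous (fun x => f x * g x).
Proof. by move=> cf cg x; apply: continuousM; [exact: cf|exact: cg]. Qed.

Lemma cont_cst c : continuous (fun _ : R => c).
Proof. by move=> x; exact: cvg_cst. Qed.

Lemma contZ c f : continuous f -> continuous (fun x => c * f x).
Proof. by move=> cf; apply: contM => //; exact: cont_cst. Qed.

Lemma cont_comp f g : continuous f -> continuous g ->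
  continuous (fun x => f (g x)).
Proof. by move=> cf cg x; apply: continuous_comp; [exact: cg|exact: cf]. Qed.

Lemma cont_scale c : continuous (fun x : R => c * x).
Proof. by apply: contZ => x; exact: cvg_id. Qed.

Lemma cont_sum n (F : nat -> R -> R) : (forall k, continuous (F k)) ->
  continuous (fun x => \sum_(k < n) F k x).
Proof.
move=> cF; elim: n => [|n IH].
  by under eq_fun do rewrite big_ord0; exact: cont_cst.
by under eq_fun do rewrite big_ord_recr /=; exact: contD.
Qed.

Definition avg g : R := \int[@lebesgue_measure R]_(x in `[0, 1]) g x.

Lemma continuous_itv_integrable g (a b : R) : continuous g ->
  (@lebesgue_measure R).-integrable `[a, b] (EFin \o g).
Proof.
move=> cg; apply: continuous_compact_integrable; first exact: segment_compact.
exact: continuous_subspaceT.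
Qed.

Lemma avgD f g : continuous f -> continuous g ->
  avg (fun x => f x + g x) = avg f + avg g.
Proof. by move=> cf cg; rewrite /avg RintegralD//;
  exact: continuous_itv_integrable. Qed.

Lemma avgZ c f : continuous f -> avg (fun x => c * f x) = c * avg f.
Proof. by move=> cf; rewrite /avg RintegralZl//; exact: continuous_itv_integrable. Qed.

Lemma avgB f g : continuous f -> continuous g ->
  avg (fun x => f x - g x) = avg f - avg g.
Proof. by move=> cf cg; rewrite /avg RintegralB//;
  exact: continuous_itv_integrable. Qed.

Lemma avg_cst c : avg (fun _ => c) = c.
Proof.
rewrite /avg Rintegral_cst//= lebesgue_measure_itv/= lte_fin ltr01 EFinN /=.
by rewrite oppr0 addr0 mulr1.
Qed.

Lemma avg_sum n (F : nat -> R -> R) : (forall k, continuous (F k)) ->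
  avg (fun x => \sum_(k < n) F k x) = \sum_(k < n) avg (F k).
Proof.
move=> cF; elim: n => [|n IH].
  by rewrite big_ord0; under [X in avg X]eq_fun do rewrite big_ord0; exact: avg_cst.
under [X in avg X]eq_fun do rewrite big_ord_recr /=.
by rewrite avgD ?big_ord_recr ?IH//; exact: cont_sum.
Qed.

Lemma le_avg f g : continuous f -> continuous g ->
  (forall x, f x <= g x) -> avg f <= avg g.
Proof.
by move=> cf cg fg; apply: le_Rintegral => //; exact: continuous_itv_integrable.
Qed.

Lemma norm_avg_le f g : continuous f -> continuous g ->
  (forall x, `|f x| <= g x) -> `|avg f| <= avg g.
Proof.
move=> cf cg fg; rewrite ler_norml; apply/andP; split.
  rewrite -mulN1r -avgZ//; apply: le_avg => //; first exact: contZ.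
  by move=> x; rewrite mulN1r; have := fg x; rewrite ler_norml => /andP[].
by apply: le_avg => // x; have := fg x; rewrite ler_norml => /andP[].
Qed.

Lemma norm_avg f d : continuous f -> (forall x, `|f x| <= d) -> `|avg f| <= d.
Proof. by move=> cf fd; rewrite -[d]avg_cst; apply: norm_avg_le => //;
  exact: cont_cst. Qed.

Lemma avg_derive f g : (forall x, is_derive x 1 f (g x)) -> continuous g ->
  avg g = f 1 - f 0.
Proof.
move=> df cg.
have cf : continuous f.
  move=> x; apply/differentiable_continuous/derivable1_diffP.
  by case: (df x).
rewrite /avg /Rintegral (@continuous_FTC2 _ _ f) //.
- exact: continuous_subspaceT.
- split.
  + by move=> x _; case: (df x).
  + exact/cvg_at_right_filter/cf.
  + exact/cvg_at_left_filter/cf.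
- by move=> x _; rewrite derive1E; exact: derive_val.
Qed.

Lemma avg_cosr (b : R) : b != 0 -> sin b = 0 -> avg (fun x => cos (b * x)) = 0.
Proof.
move=> b0 sb.
have D x : is_derive x 1 (fun x => b^-1 * sin (b * x)) (cos (b * x)).
  have -> : (fun x => b^-1 * sin (b * x)) = b^-1 \*: (sin \o (b \*: id)).
    by apply/funext.
  apply: is_derive_eq.
  by rewrite /GRing.scale/= ?mulr1; field.
have cc : continuous (fun x : R => cos (b * x)).
  by apply: cont_comp; [exact: continuous_cos|exact: cont_scale].
by rewrite (avg_derive _ _ D cc) mulr1 mulr0 sin0 sb mulr0 subrr.
Qed.

Definition cosm m x : R := cos (2 * pi * m%:R * x).

Lemma cont_cosm m : continuous (cosm m).
Proof. by apply: cont_comp; [exact: continuous_cos|exact: cont_scale]. Qed.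

Lemma cosm0 x : cosm 0%N x = 1.
Proof. by rewrite /cosm mulr0 mul0r cos0. Qed.

Lemma cosm_le1 m x : `|cosm m x| <= 1.
Proof. exact: cos_max. Qed.

Let pi2E m : 2 * pi * m%:R = (pi *+ 2) *+ m :> R.
Proof. by rewrite -[RHS]mulr_natr mulr2n; congr (_ * _); ring. Qed.

Lemma sin2pinD m x : sin (x + 2 * pi * m%:R) = sin x.
Proof. by rewrite pi2E periodicn//; exact: sinD2pi. Qed.

Lemma cos2pinD m x : cos (x + 2 * pi * m%:R) = cos x.
Proof. by rewrite pi2E periodicn//; exact: cosD2pi. Qed.

Lemma sin2pin m : sin (2 * pi * m%:R : R) = 0.
Proof. by rewrite -[X in sin X]add0r sin2pinD sin0. Qed.

Lemma cosm_periodic m : periodic (cosm m) 1.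
Proof. by move=> x; rewrite /cosm mulrDr mulr1 cos2pinD. Qed.

Lemma cosm_even m x : cosm m (- x) = cosm m x.
Proof. by rewrite /cosm mulrN cosN. Qed.

Lemma avg_cos_cos k l : avg (fun x => cosm k x * cosm l x)
  = (k == l)%:R * (if k == 0%N then 1 else 2^-1).
Proof.
have E x : cosm k x * cosm l x = 2^-1 * cos (2 * pi * (k + l)%:R * x)
    + 2^-1 * cos ((2 * pi * k%:R - 2 * pi * l%:R) * x).
  have -> : 2 * pi * (k + l)%:R * x = 2 * pi * k%:R * x + 2 * pi * l%:R * x.
    by rewrite natrD; ring.
  by rewrite /cosm mulrBl cosB cosD; field.
under [X in avg X]eq_fun do rewrite E.
have cc b : continuous (fun x : R => cos (b * x)).
  by apply: cont_comp; [exact: continuous_cos|exact: cont_scale].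
rewrite avgD ?avgZ //; try exact: contZ.
have pi0 : (pi : R) != 0 by rewrite gt_eqF ?pi_gt0.
have A m : avg (fun x : R => cos (2 * pi * m%:R * x)) = (m == 0%N)%:R.
  case: (eqVneq m 0%N) => [->|m0].
    under [X in avg X]eq_fun do rewrite mulr0 mul0r cos0.
    by rewrite avg_cst.
  rewrite avg_cosr ?sin2pin// !mulf_neq0 ?pnatr_eq0//.
rewrite A addn_eq0; case: (eqVneq k l) => [<-|kl].
  under [X in avg X]eq_fun do rewrite subrr mul0r cos0.
  rewrite avg_cst andbb; case: ifP => _ /=; lra.
rewrite mul0r avg_cosr.
- have -> : (k == 0%N) && (l == 0%N) = false.
    by apply/negbTE; apply: contra kl => /andP[/eqP-> /eqP->].
  by rewrite !mulr0 addr0.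
- rewrite -mulrBr !mulf_neq0 ?pnatr_eq0//.
  by rewrite subr_eq0 eqr_nat.
- by rewrite sinB !sin2pin mul0r mulr0 subrr.
Qed.

Lemma avg_reflect g : continuous g -> avg (fun x => g (1 - x)) = avg g.
Proof.
move=> cg; rewrite [RHS]/avg (@Rintegration_by_substitution_onem _ g 1).
- by rewrite unstable.onem1.
- by rewrite ler01 lexx.
- exact: continuous_subspaceT.
Qed.

(** The integrand changes sign under [x |-> 1 - x], by evenness and
periodicity. *)
Lemma avg_sin_even g m : continuous g -> periodic g 1 ->
  (forall x, g (- x) = g x) ->
  avg (fun x => g x * sin (2 * pi * m%:R * x)) = 0.
Proof.
move=> cg pg eg.
have cs : continuous (fun x => g x * sin (2 * pi * m%:R * x)).
  apply: contM => //.
  by apply: cont_comp; [exact: continuous_sin|exact: cont_scale].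
have := avg_reflect _ cs.
have E x : g (1 - x) * sin (2 * pi * m%:R * (1 - x))
    = -1 * (g x * sin (2 * pi * m%:R * x)).
  rewrite addrC pg eg mulrDr mulr1 sin2pinD mulrN sinN; ring.
under [X in avg X = _]eq_fun do rewrite E.
rewrite avgZ//; lra.
Qed.

Lemma avg_scale g (T : R) : 0 < T -> continuous g ->
  T^-1 * (\int[@lebesgue_measure R]_(x in `[0, T]) g (x / T)) = avg g.
Proof.
move=> T0 cg.
have cT : continuous (fun x : R => x / T).
  by under eq_fun do rewrite mulrC; exact: cont_scale.
have DT : (fun x : R => x / T)^`() = cst T^-1.
  apply/funext => x; rewrite derive1E.
  have -> : (fun x : R => x / T) = T^-1 \*: id.
    by apply/funext => y /=; rewrite mulrC.
  by rewrite derive_val /GRing.scale/= mulr1.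
have := @integration_by_substitution_increasing R (fun x => x / T) g 0 T (ltW T0).
rewrite mul0r divff ?gt_eqF// DT => H.
rewrite /avg {2}/Rintegral H.
- rewrite -RintegralZl//; last first.
    by apply: continuous_itv_integrable; exact: cont_comp.
  rewrite /Rintegral; congr fine; apply: eq_integral => x _ /=.
  by rewrite mulrC.
- by move=> x y _ _ xy; rewrite ltr_pM2r ?invr_gt0.
- by move=> x _; exact: cvg_cst.
- exact: is_cvg_cst.
- exact: is_cvg_cst.
- split.
  + by move=> x _; apply: derivableM.
  + exact/cvg_at_right_filter/cT.
  + exact/cvg_at_left_filter/cT.
- exact: continuous_subspaceT.
Qed.

End Average.

(** * Uniform limits and contractions *)

Section Uniform.
Context {R : realType}.
Implicit Types (d e : R) (u v : R -> R).

Lemma uniform_limit_continuous (V : nat -> R -> R) v :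
  (forall n, continuous (V n)) ->
  (forall e, 0 < e -> exists n, forall x, `|V n x - v x| <= e) ->
  continuous v.
Proof.
move=> cV Vv x; apply/cvgrPdist_le => e e0.
have e3 : 0 < e / 3 by rewrite divr_gt0.
have [n nV] := Vv _ e3.
have /cvgrPdist_le/(_ _ e3) H := cV n x.
near=> t.
have Ht : `|V n x - V n t| <= e / 3 by near: t; exact: H.
have -> : v x - v t = (V n x - V n t) - (V n x - v x) + (V n t - v t) by ring.
rewrite (le_trans (ler_normD _ _))// (_ : e = e / 3 + e / 3 + e / 3); last by field.
apply: lerD => //; rewrite (le_trans (ler_normB _ _))//; exact: lerD.
Unshelve. all: by end_near.
Qed.

(** Completeness for the sup norm, in the quantitative form used below: the
Cauchy rate [b] is also the rate of convergence to the pointwise limit. *)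
Lemma uniform_cauchy (V : nat -> R -> R) (b : nat -> R) :
  (forall n k x, `|V (n + k)%N x - V n x| <= b n) -> b @ \oo --> (0 : R) ->
  forall n x, `|V n x - lim (V m x @[m --> \oo])| <= b n.
Proof.
move=> Vb b0 n x.
have cV : cvg (V m x @[m --> \oo]).
  apply/cauchy_cvgP/cauchy_exP => e e0.
  have [m _ Hm] : \forall m \near \oo, `|b m| < e.
    have /cvgrPdist_lt/(_ _ e0) := b0.
    by apply: filterS => m; rewrite sub0r normrN.
  exists (V m x); exists m => // k /= mk; rewrite /ball/= distrC.
  rewrite -(subnKC mk) (le_lt_trans (Vb _ _ _))//.
  by rewrite (le_lt_trans (ler_norm _))//; exact: (Hm m (leqnn m)).
have H : `|V n x - V m x| @[m --> \oo] --> `|V n x - lim (V m x @[m --> \oo])|.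
  by apply: cvg_norm; apply: cvgB => //; exact: cvg_cst.
rewrite -(cvg_lim _ H)//; apply: limr_le; first by apply/cvg_ex; eexists; exact: H.
by exists n => // m /= nm; rewrite distrC -(subnKC nm) Vb.
Qed.

Lemma cvg_geometric_half : (2^-1 ^+ n : R) @[n --> \oo] --> (0 : R).
Proof. by apply: cvg_expr; rewrite ger0_norm ?invr_ge0//; lra. Qed.

(** The contraction principle for a set [P] of functions bounded by 1 that is
closed under uniform limits. The sup norm is spelled out by pointwise bounds, so
that no normed space of bounded functions has to be built. *)
Lemma contraction_fixpoint (P : set (R -> R)) (Phi : (R -> R) -> R -> R) v0 :
  P v0 -> (forall v, P v -> P (Phi v)) ->
  (forall v x, P v -> `|v x| <= 1) ->
  (forall u v d, P u -> P v -> (forall x, `|u x - v x| <= d) ->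
    forall x, `|Phi u x - Phi v x| <= 2^-1 * d) ->
  (forall (V : nat -> R -> R) v, (forall n, P (V n)) ->
    (forall e, 0 < e -> exists n, forall m x, (n <= m)%N -> `|V m x - v x| <=
      e) -> P v) ->
  exists2 v, P v & forall x, Phi v x = v x.
Proof.
move=> P0 PPhi P1 Phic Pcl.
pose V n := iter n Phi v0.
have PV n : P (V n) by elim: n => //= n; exact: PPhi.
have step n : forall x, `|V n.+1 x - V n x| <= 2 * 2^-1 ^+ n.
  elim: n => [|n IH] x.
    rewrite expr0 mulr1 (le_trans (ler_normB _ _))// (_ : 2 = 1 + 1)//.
    by apply: lerD; apply: P1; exact: PV.
  by rewrite exprS mulrCA; apply: Phic (PV n.+1) (PV n) IH x.
have VC n k x : `|V (n + k)%N x - V n x| <= 4 * 2^-1 ^+ n.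
  suff : `|V (n + k)%N x - V n x| <= 4 * 2^-1 ^+ n * (1 - 2^-1 ^+ k).
    by move=> /le_trans; apply; rewrite ler_piMr// gerBl exprn_ge0.
  elim: k => [|k IH]; first by rewrite addn0 !subrr normr0 mulr0.
  rewrite addnS (_ : V (n + k).+1 x - V n x
    = (V (n + k).+1 x - V (n + k)%N x) + (V (n + k)%N x - V n x)); last by ring.
  rewrite (le_trans (ler_normD _ _))// (le_trans (lerD (step _ _) IH))//.
  by rewrite exprS exprD le_eqVlt; apply/orP; left; apply/eqP; field.
have b0 : 4 * (2^-1 : R) ^+ n @[n --> \oo] --> (0 : R).
  by rewrite -[X in _ --> X](mulr0 4); apply: cvgM;
    [exact: cvg_cst|exact: cvg_geometric_half].
pose v x := lim (V m x @[m --> \oo]).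
have Vv n x : `|V n x - v x| <= 4 * 2^-1 ^+ n := uniform_cauchy _ _ VC b0 n x.
have ev e : 0 < e -> exists n, forall m x, (n <= m)%N -> `|V m x - v x| <= e.
  move=> e0; have /cvgrPdist_le/(_ _ e0)[n _ Hn] := b0.
  exists n => m x nm; rewrite (le_trans (Vv _ _))//.
  by have := Hn m nm; rewrite /= sub0r normrN; exact/le_trans/ler_norm.
have Pv : P v by exact: Pcl PV ev.
exists v => // x; apply/eqP; rewrite -subr_eq0 -normr_le0; apply/ler_addgt0Pl => e e0.
rewrite addr0; have e2 : 0 < e / 2 by rewrite divr_gt0.
have [n Hn] := ev _ e2.
rewrite (_ : Phi v x - v x = - (V n.+1 x - Phi v x) + (V n.+1 x - v x)); last by ring.
rewrite (_ : e = e / 2 + e / 2); last by field.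
rewrite (le_trans (ler_normD _ _))// lerD//; last exact: Hn.
rewrite normrN; apply: (le_trans (Phic _ _ (e / 2) (PV n) Pv _ x)).
  by move=> y; exact: Hn.
by lra.
Qed.

End Uniform.

(** * Fejer kernels *)

Section Fejer.
Context {R : realType}.
Implicit Types (d e : R) (u v : R -> R) (w a : nat -> R).

(** The inverse of the mean square of the mode [k]. *)
Definition mode_weight (k : nat) : R := if k == 0%N then 1 else 2.

Definition dirichlet n (t : R) : R := \sum_(k < n.+1) mode_weight k * cosm k t.

(** The unnormalized kernel, of total mass [n + 1]. *)
Definition fejer n (t : R) : R := \sum_(k < n.+1) dirichlet k t.

Let sinm (m : nat) (x : R) : R := sin (2 * pi * m%:R * x).

(** The kernel is [|\sum_(j <= n) e^(2 pi i j t)|^2]. Passing from [n] to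
[n + 1] adds [1] and twice the real part of the product of the new exponential
with the conjugates of the old ones, which is the next Dirichlet kernel. *)
Lemma fejerE n t : fejer n t
  = (\sum_(j < n.+1) cosm j t) ^+ 2 + (\sum_(j < n.+1) sinm j t) ^+ 2.
Proof.
elim: n => [|n IH].
  rewrite /fejer /dirichlet !big_ord1 /mode_weight/= mul1r cosm0 /sinm.
  by rewrite mulr0 mul0r sin0; ring.
rewrite /fejer big_ord_recr/= -/(fejer n t) IH [in RHS]big_ord_recr/=.
rewrite [X in _ = _ + X ^+ 2]big_ord_recr/=.
set A := \sum_(j < n.+1) cosm j t; set B := \sum_(j < n.+1) sinm j t.
have cs : cosm n.+1 t ^+ 2 + sinm n.+1 t ^+ 2 = 1 by exact: cos2Dsin2.
have AB : A * cosm n.+1 t + B * sinm n.+1 t = \sum_(j < n.+1) cosm j.+1 t.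
  rewrite /A /B !mulr_suml -big_split/= [RHS](reindex_inj rev_ord_inj)/=.
  apply: eq_bigr => j _; rewrite subSS -subSn ?leq_ord// /cosm /sinm.
  rewrite natrB ?(leq_trans (leq_ord j))// mulrBr mulrBl cosB.
  by rewrite [cos (2 * pi * n.+1%:R * t) * _]mulrC [sin (2 * pi * n.+1%:R * t)
    * _]mulrC.
have -> : dirichlet n.+1 t = 1 + 2 * (A * cosm n.+1 t + B * sinm n.+1 t).
  rewrite AB /dirichlet big_ord_recl/= cosm0 /mode_weight/= mul1r; congr (_ + _).
  by rewrite mulr_sumr; apply: eq_bigr.
by rewrite -[X in _ + (X + _)]cs; ring.
Qed.

Lemma fejer_ge0 n t : 0 <= fejer n t.
Proof. by rewrite fejerE addr_ge0// sqr_ge0. Qed.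

(** Half the sum of the kernel at [x - y] and at [x + y]
([fejer_symE]). Integration against it sees only the cosine modes, so that no
sine coefficients appear in the multipliers. *)
Definition fejer_sym n (x y : R) : R :=
  \sum_(k < n.+1) \sum_(j < k.+1) mode_weight j * cosm j x * cosm j y.

Lemma fejer_symE n x y : fejer_sym n x y = 2^-1 * (fejer n (x - y) + fejer n (x + y)).
Proof.
rewrite /fejer_sym /fejer -big_split/= mulr_sumr; apply: eq_bigr => k _.
rewrite /dirichlet -big_split/= mulr_sumr; apply: eq_bigr => j _.
rewrite /cosm; set b := 2 * pi * j%:R.
by rewrite [b * (x - y)]mulrBr [b * (x + y)]mulrDr cosB cosD; field.
Qed.

Lemma fejer_sym_ge0 n x y : 0 <= fejer_sym n x y.
Proof. by rewrite fejer_symE mulr_ge0// ?addr_ge0 ?fejer_ge0// invr_ge0. Qed.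

Lemma cont_fejer_sym n x : continuous (fejer_sym n x).
Proof.
apply: (@cont_sum _ _ (fun k y => \sum_(j < k.+1) mode_weight j * cosm j x *
  cosm j y)) => k.
apply: (@cont_sum _ _ (fun j y => mode_weight j * cosm j x * cosm j y)) => j.
by apply: contZ; exact: cont_cosm.
Qed.

Lemma avg_cosm m : avg (@cosm R m) = (m == 0%N)%:R.
Proof.
have := @avg_cos_cos R m 0%N; under [X in avg X]eq_fun do rewrite cosm0 mulr1.
by move=> ->; case: eqP => _; rewrite ?mulr1 ?mul0r.
Qed.

Lemma avg_fejer_sym n x : avg (fejer_sym n x) = n.+1%:R.
Proof.
rewrite [LHS](@avg_sum _ _ (fun k y => \sum_(j < k.+1) mode_weight j * cosm j x
  * cosm j y)).
  rewrite -[n.+1 in RHS]card_ord -sumr_const; apply: eq_bigr => k _.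
  rewrite (@avg_sum _ _ (fun j y => mode_weight j * cosm j x * cosm j y)).
    rewrite big_ord_recl/= avgZ; last exact: cont_cosm.
    rewrite avg_cosm cosm0 /mode_weight/= !mulr1 big1 ?addr0// => j _.
    by rewrite avgZ ?avg_cosm ?mulr0//; exact: cont_cosm.
  by move=> j; apply: contZ; exact: cont_cosm.
move=> k; apply: (@cont_sum _ _ (fun j y => mode_weight j * cosm j x * cosm j y)) => j.
by apply: contZ; exact: cont_cosm.
Qed.

Definition fejer_op n u (x : R) : R :=
  \sum_(k < n.+1) \sum_(j < k.+1) mode_weight j * avg (fun y => u y * cosm j y)
    * cosm j x.

Lemma fejer_opE n u x : continuous u ->
  fejer_op n u x = avg (fun y => u y * fejer_sym n x y).
Proof.
move=> cu.
have E y : u y * fejer_sym n x y = \sum_(k < n.+1) \sum_(j < k.+1)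
   (mode_weight j * cosm j x) * (u y * cosm j y).
  rewrite /fejer_sym mulr_sumr; apply: eq_bigr => k _; rewrite mulr_sumr.
  by apply: eq_bigr => j _; ring.
have cF j : continuous (fun y => (mode_weight j * cosm j x) * (u y * cosm j y)).
  by apply: contZ; apply: contM => //; exact: cont_cosm.
under [X in avg X]eq_fun do rewrite E.
rewrite (@avg_sum _ _ (fun k y => \sum_(j < k.+1)
   (mode_weight j * cosm j x) * (u y * cosm j y))); last first.
  by move=> k; exact: (@cont_sum _ _ (fun j y => (mode_weight j * cosm j x) *
    (u y * cosm j y))).
apply: eq_bigr => k _.
rewrite (@avg_sum _ _ (fun j y => (mode_weight j * cosm j x) * (u y * cosm j y)))//.
apply: eq_bigr => j _; rewrite avgZ; first by ring.
by apply: contM => //; exact: cont_cosm.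
Qed.

Lemma fejer_op_le n u d x : continuous u -> (forall y, `|u y| <= d) ->
  `|fejer_op n u x| <= n.+1%:R * d.
Proof.
move=> cu ud; rewrite fejer_opE// mulrC -(avg_fejer_sym n x) -avgZ;
  last exact: cont_fejer_sym.
apply: norm_avg_le.
- by apply: contM => //; exact: cont_fejer_sym.
- by apply: contZ; exact: cont_fejer_sym.
- by move=> y; rewrite normrM (ger0_norm (fejer_sym_ge0 _ _ _)) ler_wpM2r//
  fejer_sym_ge0.
Qed.

Lemma cont_fejer_op n u : continuous (fejer_op n u).
Proof.
apply: (@cont_sum _ _ (fun k x => \sum_(j < k.+1) mode_weight j * avg (fun y =>
  u y * cosm j y) * cosm j x)) => k.
apply: (@cont_sum _ _ (fun j x => mode_weight j * avg (fun y => u y * cosm j y)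
  * cosm j x)) => j.
by apply: contZ; exact: cont_cosm.
Qed.

Lemma fejer_op_periodic n u : periodic (fejer_op n u) 1.
Proof.
move=> x; rewrite /fejer_op; apply: eq_bigr => k _; apply: eq_bigr => j _.
by rewrite cosm_periodic.
Qed.

Lemma fejer_op_even n u x : fejer_op n u (- x) = fejer_op n u x.
Proof.
rewrite /fejer_op; apply: eq_bigr => k _; apply: eq_bigr => j _.
by rewrite cosm_even.
Qed.

Lemma fejer_opB n u v x : continuous u -> continuous v ->
  fejer_op n (fun y => u y - v y) x = fejer_op n u x - fejer_op n v x.
Proof.
move=> cu cv; rewrite !fejer_opE//; last exact: contB.
rewrite -avgB; try by apply: contM => //; exact: cont_fejer_sym.
by congr avg; apply/funext => y; ring.
Qed.

Lemma sum_ord_eq n m : \sum_(j < n) ((j == m :> nat)%:R : R) = (m < n)%N%:R.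
Proof.
elim: n => [|n IH]; first by rewrite big_ord0.
rewrite big_ord_recr/= IH ltnS; case: (ltngtP m n) => _; rewrite ?addr0 ?add0r//.
Qed.

Lemma sum_ord_le n m : \sum_(k < n.+1) ((m <= k)%N%:R : R) = (n.+1 - m)%N%:R.
Proof.
elim: n => [|n IH].
  by rewrite big_ord1; case: m.
rewrite big_ord_recr/= IH; case: (leqP m n.+1) => mn.
  by rewrite -natrD addn1 -subSn.
have /eqP-> : (n.+1 - m == 0)%N by rewrite subn_eq0 ltnW.
by have /eqP-> : (n.+2 - m == 0)%N; rewrite ?subn_eq0 ?addr0.
Qed.

(** The Fejer operator is the multiplier with the triangle
[max (n + 1 - m, 0)] as its symbol: the mode [m] occurs in the Dirichlet kernels
of index [m], ..., [n]. *)
Lemma fejer_op_coef n u m : avg (fun x => fejer_op n u x * cosm m x)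
  = (n.+1 - m)%N%:R * avg (fun y => u y * cosm m y).
Proof.
set U := avg (fun y => u y * cosm m y).
have E x : fejer_op n u x * cosm m x = \sum_(k < n.+1) \sum_(j < k.+1)
   (mode_weight j * avg (fun y => u y * cosm j y)) * (cosm j x * cosm m x).
  rewrite /fejer_op mulr_suml; apply: eq_bigr => k _; rewrite mulr_suml.
  by apply: eq_bigr => j _; ring.
have cF j : continuous (fun x => (mode_weight j * avg (fun y => u y * cosm j
  y)) * (cosm j x * cosm m x)).
  by apply: contZ; apply: contM; exact: cont_cosm.
under [X in avg X]eq_fun do rewrite E.
rewrite (@avg_sum _ _ (fun k x => \sum_(j < k.+1)
   (mode_weight j * avg (fun y => u y * cosm j y)) * (cosm j x * cosm m x)));
     last first.
  by move=> k; exact: (@cont_sum _ _ (fun j x => (mode_weight j * avg (fun y =>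
    u y * cosm j y)) * (cosm j x * cosm m x))).
rewrite -sum_ord_le mulr_suml; apply: eq_bigr => k _.
rewrite (@avg_sum _ _ (fun j x => (mode_weight j * avg (fun y => u y * cosm j
  y)) * (cosm j x * cosm m x)))//.
rewrite -ltnS -sum_ord_eq mulr_suml; apply: eq_bigr => j _.
rewrite avgZ; last by apply: contM; exact: cont_cosm.
rewrite avg_cos_cos /mode_weight /U; case: (eqVneq (j : nat) m) => [->|_];
  last by rewrite !mul0r mulr0.
by case: ifP => _; field.
Qed.

End Fejer.

(** * Multipliers with convex symbols *)

Section Multiplier.
Context {R : realType}.
Implicit Types (d e : R) (u v : R -> R) (a : nat -> R).

Definition bounded_by d u := forall x : R, `|u x| <= d :> R.

Definition bounded_continuous u := continuous u /\ exists d, bounded_by d u.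

(** The properties of the operator [K] with symbol [a] on cosine modes that the
fixed point argument uses; [C] bounds its norm for the sup norm. *)
Definition cosine_multiplier a (C : R) (K : (R -> R) -> R -> R) : Prop :=
  [/\ forall u, bounded_continuous u -> [/\ continuous (K u), periodic (K u) 1,
        forall x, K u (- x) = K u x &
        forall m, avg (fun x => K u x * cosm m x) = a m * avg (fun x => u x *
          cosm m x)],
      forall u v x, bounded_continuous u -> bounded_continuous v -> K (fun y =>
        u y - v y) x = K u x - K v x &
      forall u d, continuous u -> bounded_by d u -> bounded_by (C * d) (K u)].

Section Convex.
Variable a : nat -> R.
Hypothesis a_decr : forall n, a n.+1 <= a n.
Hypothesis a_convex : forall n, 0 <= a n - 2 * a n.+1 + a n.+2.
Hypothesis a_cvg0 : a @ \oo --> 0.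

Let w n : R := a n - 2 * a n.+1 + a n.+2.

Let a_le n k : a (n + k)%N <= a n.
Proof. by elim: k => [|k IH]; rewrite ?addn0 ?lexx// addnS (le_trans (a_decr _)). Qed.

Let a_ge0 n : 0 <= a n.
Proof.
rewrite -(cvg_lim _ a_cvg0)//; apply: limr_le; first by apply/cvg_ex; exists 0.
by exists n => // m /= nm; rewrite -(subnKC nm).
Qed.

(** Summation by parts: the triangles weighted by the second differences of
[a] sum up to [a], up to a remainder that tends to [0] (see [tail_cvg0]). *)
Let sum_w m k : \sum_(n < m + k) w n * (n.+1 - m)%N%:R
  = a m - a (m + k)%N - k%:R * (a (m + k)%N - a (m + k).+1).
Proof.
elim: k => [|k IH].
  rewrite addn0 big1 ?mul0r ?subrr ?subr0// => i _.
  by have /eqP-> : (i.+1 - m == 0)%N; rewrite ?subn_eq0 ?mulr0.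
rewrite addnS big_ord_recr/= IH subSn ?leq_addr// addKn /w.
by rewrite -natr1; ring.
Qed.

(** The differences of a convex sequence decrease, so the last one is at most
the average of those before it. *)
Let ndiff_le h k : k.+1%:R * (a (h + k)%N - a (h + k).+1) <= a h - a (h + k).+1.
Proof.
elim: k => [|k IH]; first by rewrite addn0 mul1r.
have := a_convex (h + k)%N; rewrite addnS -[k.+2%:R]natr1 => H.
have : k.+1%:R * (a (h + k).+1 - a (h + k).+2) <= k.+1%:R * (a (h + k)%N - a (h
  + k).+1).
  by rewrite ler_wpM2l//; lra.
by lra.
Qed.

(** The part of the total mass [a 0] that is carried by the kernels of index at
least [n]. *)
Let tail n : R := a n + n%:R * (a n - a n.+1).

Let tail_ge0 n : 0 <= tail n.
Proof. by rewrite addr_ge0// mulr_ge0// subr_ge0. Qed.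

(** Monotone differences of a convergent sequence are [o(1/n)]: compare with the
sum of the differences over the second half of [0, ..., n]. *)
Let tail_cvg0 : tail @ \oo --> 0.
Proof.
apply/cvgrPdist_le => e e0.
have e3 : 0 < e / 3 by rewrite divr_gt0.
have /cvgrPdist_le/(_ _ e3)[n0 _ Hn] := a_cvg0.
exists (n0.*2).+1 => // n /= nn0; rewrite sub0r normrN ger0_norm// /tail.
pose h := n./2; pose k := (n - h)%N.
have nhk : n = (h + k)%N by rewrite /h /k; lia.
have n2k : (n <= 2 * k.+1)%N by rewrite /k /h; lia.
have n0h : (n0 <= h)%N by rewrite /h; lia.
have ah : a h <= e / 3 by have := Hn h n0h; rewrite /= sub0r normrN ger0_norm.
have an : a n <= e / 3 by apply: le_trans ah; rewrite nhk.
suff : n%:R * (a n - a n.+1) <= 2 * a h by lra.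
have dn : 0 <= a n - a n.+1 by rewrite subr_ge0.
apply: (@le_trans _ _ ((2 * k.+1)%N%:R * (a n - a n.+1))).
  by rewrite ler_wpM2r// ler_nat.
rewrite natrM -mulrA ler_wpM2l//.
have := ndiff_le h k; rewrite -nhk => /le_trans; apply.
by rewrite gerBl.
Qed.

Let V u N x := \sum_(n < N) w n * fejer_op n u x.

Let V_cauchy u d N k x : continuous u -> bounded_by d u ->
  `|V u (N + k) x - V u N x| <= tail N * d.
Proof.
move=> cu ud.
have d0 : 0 <= d by apply: le_trans (ud 0).
suff : `|V u (N + k) x - V u N x| <= (tail N - tail (N + k)) * d.
  by move=> /le_trans; apply; rewrite ler_wpM2r// gerBl.
elim: k => [|k IH]; first by rewrite addn0 !subrr normr0 mul0r.
rewrite addnS {1}/V big_ord_recr/= -/(V u (N + k) x) addrAC.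
rewrite (le_trans (ler_normD _ _))//.
have -> : (tail N - tail (N + k).+1) * d
    = (tail N - tail (N + k)) * d + w (N + k) * ((N + k).+1%:R * d).
  by rewrite /tail /w -natr1; ring.
apply: lerD => //; rewrite normrM ger0_norm ?a_convex//.
by apply: ler_wpM2l; [exact: a_convex|exact: fejer_op_le].
Qed.

Let K u x := lim (V u N x @[N --> \oo]).

Let V_dist u d N x : continuous u -> bounded_by d u ->
  `|V u N x - K u x| <= tail N * d.
Proof.
move=> cu ud; apply: (@uniform_cauchy _ (V u) (fun N => tail N * d)).
  by move=> n k y; exact: V_cauchy.
by rewrite -[X in _ --> X](mul0r d); apply: cvgM => //; exact: cvg_cst.
Qed.

Let V_cvg u x : bounded_continuous u -> V u N x @[N --> \oo] --> K u x.
Proof.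
move=> [cu [d ud]]; apply/cvgrPdist_le => e e0.
have taild : tail N * d @[N --> \oo] --> 0.
  by rewrite -[X in _ --> X](mul0r d); apply: cvgM => //; exact: cvg_cst.
have /cvgrPdist_le/(_ _ e0)[n _ Hn] := taild.
exists n => // m /= nm; rewrite distrC (le_trans (V_dist _ _ _ _ cu ud))//.
by have := Hn m nm; rewrite /= sub0r normrN; exact/le_trans/ler_norm.
Qed.

Let cont_V u N : continuous (V u N).
Proof.
apply: (@cont_sum _ _ (fun n x => w n * fejer_op n u x)) => n.
by apply: contZ; exact: cont_fejer_op.
Qed.

Let V_coef u N m : avg (fun x => V u N x * cosm m x)
  = (\sum_(n < N) w n * (n.+1 - m)%N%:R) * avg (fun x => u x * cosm m x).
Proof.
under [X in avg X]eq_fun do rewrite mulr_suml.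
have cF n : continuous (fun x => w n * fejer_op n u x * cosm m x).
  by apply: contM; [apply: contZ; exact: cont_fejer_op|exact: cont_cosm].
rewrite (@avg_sum _ _ (fun n x => w n * fejer_op n u x * cosm m x))//.
rewrite mulr_suml; apply: eq_bigr => n _.
under [X in avg X]eq_fun do rewrite -mulrA.
rewrite avgZ ?fejer_op_coef ?mulrA//.
by apply: contM; [exact: cont_fejer_op|exact: cont_cosm].
Qed.

(** The weights of the Fejer kernels are nonnegative, hence the norm is at most
the total mass, which is [a 0]. *)
Lemma convex_multiplier : exists K', cosine_multiplier a (a 0%N) K'.
Proof.
exists K; split.
- move=> u bu; have [cu [d ud]] := bu.
  have d0 : 0 <= d by apply: le_trans (ud 0).
  have taild : tail N * d @[N --> \oo] --> 0.
    by rewrite -[X in _ --> X](mul0r d); apply: cvgM => //; exact: cvg_cst.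
  have ev e : 0 < e -> exists n, forall x, `|V u n x - K u x| <= e.
    move=> e0; have /cvgrPdist_le/(_ _ e0)[n _ Hn] := taild.
    exists n => x; rewrite (le_trans (V_dist _ _ _ _ cu ud))//.
    by have := Hn n (leqnn n); rewrite /= sub0r normrN; exact/le_trans/ler_norm.
  have cK : continuous (K u) by exact: uniform_limit_continuous (cont_V u) ev.
  split => //.
  + move=> x; rewrite /K.
    suff -> : (fun N => V u N (x + 1)) = (fun N => V u N x) by [].
    apply/funext => N; rewrite /V.
    by apply: eq_bigr => n _; rewrite fejer_op_periodic.
  + move=> x; rewrite /K.
    suff -> : (fun N => V u N (- x)) = (fun N => V u N x) by [].
    apply/funext => N; rewrite /V.
    by apply: eq_bigr => n _; rewrite fejer_op_even.
  + move=> m; set U := avg (fun x => u x * cosm m x).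
    have L1 : avg (fun x => V u N x * cosm m x) @[N --> \oo]
        --> avg (fun x => K u x * cosm m x).
      apply/cvgrPdist_le => e e0; have /cvgrPdist_le/(_ _ e0)[n _ Hn] := taild.
      exists n => // N /= nN; rewrite distrC -avgB; try by apply: contM => //;
        exact: cont_cosm.
      apply: norm_avg.
        by apply: contB; apply: contM => //; exact: cont_cosm.
      move=> x; rewrite -mulrBl normrM -[leRHS]mulr1 ler_pM ?cosm_le1//.
      rewrite (le_trans (V_dist _ _ _ _ cu ud))//.
      by have := Hn N nN; rewrite /= sub0r normrN; exact/le_trans/ler_norm.
    have L2 : avg (fun x => V u N x * cosm m x) @[N --> \oo] --> a m * U.
      rewrite -(cvg_shiftn m); under eq_fun do rewrite V_coef addnC sum_w.
      apply: cvgM; last exact: cvg_cst.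
      apply/cvgrPdist_le => e e0; have /cvgrPdist_le/(_ _ e0)[n _ Hn] := tail_cvg0.
      exists n => // k /= nk.
      have := Hn (m + k)%N (leq_trans nk (leq_addl _ _)).
      rewrite /= sub0r normrN ger0_norm// => H.
      have da : 0 <= a (m + k)%N - a (m + k).+1 by rewrite subr_ge0.
      set t := k%:R * _; have -> : a m - (a m - a (m + k)%N - t) = a (m + k)%N
        + t by ring.
      rewrite ger0_norm ?addr_ge0 /t ?mulr_ge0// (le_trans _ H)// /tail lerD2l.
      by rewrite ler_wpM2r// ler_nat leq_addl.
    by rewrite -(cvg_lim _ L1)// (cvg_lim _ L2).
- move=> u v x bu bv.
  have H : V u N x - V v N x @[N --> \oo] --> K u x - K v x.
    by apply: cvgB; exact: V_cvg.
  rewrite -(cvg_lim _ H)// {1}/K.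
  suff -> : (fun N => V (fun y => u y - v y) N x) = (fun N => V u N x - V v N x) by [].
  apply/funext => N.
  rewrite /V -sumrB; apply: eq_bigr => n _.
  by rewrite fejer_opB ?mulrBr//; [case: bu|case: bv].
- move=> u d cu ud x; have := V_dist _ _ 0%N x cu ud.
  by rewrite /V big_ord0 sub0r normrN /tail mul0r addr0.
Qed.

End Convex.
End Multiplier.

(** * The multiplier of 1 / (m ^ p - 1) *)

Section Symbol.
Context {R : realType}.
Implicit Types (d e : R) (u v : R -> R) (b : nat -> R).

Lemma bounded_by_ge0 d u : bounded_by d u -> 0 <= d.
Proof. by move=> ud; exact: le_trans (ud 0). Qed.

Lemma norm_coef_le u d m : continuous u -> bounded_by d u ->
  `|avg (fun x => u x * cosm m x)| <= d.
Proof.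
move=> cu ud; apply: norm_avg; first by apply: contM => //; exact: cont_cosm.
by move=> x; rewrite normrM -[leRHS]mulr1 ler_pM ?cosm_le1.
Qed.

Lemma coefB u v m : continuous u -> continuous v ->
  avg (fun x => (u x - v x) * cosm m x)
  = avg (fun x => u x * cosm m x) - avg (fun x => v x * cosm m x).
Proof.
move=> cu cv; under [X in avg X]eq_fun do rewrite mulrBl.
by rewrite avgB//; apply: contM => //; exact: cont_cosm.
Qed.

Lemma coefZ c u m : continuous u ->
  avg (fun x => c * u x * cosm m x) = c * avg (fun x => u x * cosm m x).
Proof.
move=> cu; under [X in avg X]eq_fun do rewrite -mulrA.
by rewrite avgZ//; apply: contM => //; exact: cont_cosm.
Qed.

Lemma coef_cst c m : avg (fun x : R => c * cosm m x) = c * (m == 0%N)%:R.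
Proof. by rewrite avgZ ?avg_cosm//; exact: cont_cosm. Qed.

Lemma coef0 u : avg (fun x => u x * cosm 0%N x) = avg u.
Proof. by congr avg; apply/funext => x; rewrite cosm0 mulr1. Qed.

(** Convexity is needed for [m >= 2] only: extend [b] linearly to the modes 0
and 1, and subtract these two modes from the resulting operator. *)
Lemma highpass_multiplier b :
  (forall n, (2 <= n)%N -> b n.+1 <= b n) ->
  (forall n, (2 <= n)%N -> 0 <= b n - 2 * b n.+1 + b n.+2) ->
  b @ \oo --> 0 ->
  exists K C, 0 <= C /\
    cosine_multiplier (fun m => if (m < 2)%N then 0 else b m) C K.
Proof.
move=> b_decr b_convex b_cvg0.
(* [a] has zero second differences at 0 and at 1. *)
pose a n := if n is n'.+1 then (if n' is _.+1 then b n else 2 * b 2%N - b 3)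
            else 3 * b 2%N - 2 * b 3.
have b23 := b_decr 2%N isT.
have a_decr n : a n.+1 <= a n.
  by case: n => [|[|n]] //=; [lra|lra|exact: b_decr].
have a_convex n : 0 <= a n - 2 * a n.+1 + a n.+2.
  by case: n => [|[|n]] //=; [lra|lra|exact: b_convex].
have a_cvg0 : a @ \oo --> 0.
  rewrite -(cvg_shiftn 2); under eq_fun do rewrite addn2 /=.
  have := b_cvg0; rewrite -(cvg_shiftn 2); under eq_fun do rewrite addn2.
  by [].
have [K [K1 K2 K3]] := convex_multiplier _ a_decr a_convex a_cvg0.
pose c1 (u : R -> R) := avg (fun x => u x * cosm 1%N x).
exists (fun u x => K u x - a 0%N * avg u - 2 * a 1%N * c1 u * cosm 1%N x).
exists (`|a 0%N| + `|a 0%N| + 2 * `|a 1%N|); split;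
  first by rewrite !addr_ge0// mulr_ge0.
split.
- move=> u bu; have [cK pK eK coK] := K1 u bu.
  have cc : continuous (fun x => 2 * a 1%N * c1 u * cosm 1%N x).
    by apply: contZ; exact: cont_cosm.
  have cK0 : continuous (fun x => K u x - a 0%N * avg u).
    by apply: contB => //; exact: cont_cst.
  split.
  + exact: contB.
  + by move=> x; rewrite pK cosm_periodic.
  + by move=> x; rewrite eK cosm_even.
  + move=> m; rewrite coefB// coefB//; last exact: cont_cst.
    rewrite coK coef_cst coefZ; last exact: cont_cosm.
    rewrite avg_cos_cos; case: m => [|[|m]] //=.
    * by rewrite coef0; ring.
    * by rewrite -/(c1 u); field.
    * by ring.
- move=> u v x bu bv; have [cu _] := bu; have [cv _] := bv.
  by rewrite K2// /c1 coefB// avgB//; ring.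
- move=> u d cu ud x; have d0 := bounded_by_ge0 _ _ ud.
  have H1 := K3 u d cu ud x.
  have H2 : `|a 0%N * avg u| <= `|a 0%N| * d.
    by rewrite normrM ler_wpM2l// norm_avg.
  have H3 : `|2 * a 1%N * c1 u * cosm 1%N x| <= 2 * `|a 1%N| * d.
    rewrite -[leRHS]mulr1 normrM ler_pM ?cosm_le1// normrM.
    by rewrite normrM (ger0_norm (_ : 0 <= 2))// ler_pM// ?mulr_ge0// norm_coef_le.
  have H0 : `|K u x| <= `|a 0%N| * d by rewrite (le_trans H1)// ler_wpM2r// ler_norm.
  rewrite (le_trans (ler_normB _ _))//.
  rewrite (le_trans (lerD (ler_normB _ _) (lexx _)))//.
  by lra.
Qed.

(** The function [1 / (exp t - 1)] is convex and decreasing, and by hypothesis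
[ln y] is at least the midpoint of [ln x] and [ln z]. *)
Lemma inv_sub1_convex (x y z : R) : 1 < x -> 1 < y -> 1 < z -> x * z <= y ^+ 2 ->
  0 <= (x - 1)^-1 - 2 * (y - 1)^-1 + (z - 1)^-1.
Proof.
move=> x1 y1 z1 xz.
have X0 : 0 < x - 1 by lra.
have Y0 : 0 < y - 1 by lra.
have Z0 : 0 < z - 1 by lra.
have -> : (x - 1)^-1 - 2 * (y - 1)^-1 + (z - 1)^-1 =
  ((z - 1) * (y - 1) - 2 * ((x - 1) * (z - 1)) + (x - 1) * (y - 1))
   / ((x - 1) * (y - 1) * (z - 1)).
  by field; rewrite !gt_eqF.
apply: divr_ge0; last by rewrite !mulr_ge0// ltW.
(* With the sum [x + z] replaced by twice the geometric mean [g], the claim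
   is that [1 / (t - 1)] decreases from [g] to [y]. *)
set g := Num.sqrt (x * z).
have gg : g ^+ 2 = x * z by rewrite sqr_sqrtr// mulr_ge0//; lra.
have g0 : 0 <= g by rewrite sqrtr_ge0.
have gy : g <= y by rewrite -ler_sqr ?nnegrE ?gg//; lra.
have S2 : 2 * g <= x + z.
  rewrite -ler_sqr ?nnegrE//; [|by rewrite mulr_ge0|lra].
  rewrite exprMn gg; have := sqr_ge0 (x - z); nra.
have -> : (z - 1) * (y - 1) - 2 * ((x - 1) * (z - 1)) + (x - 1) * (y - 1)
  = (x + z - 2 * g) * (y + 1) + 2 * (g - 1) * (y - g).
  have -> : (x - 1) * (z - 1) = g ^+ 2 - (x + z) + 1 by rewrite gg; ring.
  by ring.
have g1 : 1 <= g.
  rewrite -(@ler_sqr _ 1 g) ?nnegrE// gg expr1n; nra.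
by rewrite addr_ge0// !mulr_ge0//; lra.
Qed.

Section Power.
Variable p : R.
Hypothesis p0 : 0 < p.

Lemma powR_gt1 n : (2 <= n)%N -> 1 < (n%:R : R) `^ p.
Proof.
move=> n2; rewrite -[X in X < _](_ : 1 `^ p = 1); last by rewrite powR1.
by apply: gt0_ltr_powR; rewrite ?nnegrE// ltr1n.
Qed.

Lemma power_symbol_multiplier : exists K C, 0 <= C /\
  cosine_multiplier (fun m => if (m < 2)%N then 0 else ((m%:R : R) `^ p - 1)^-1) C K.
Proof.
apply: (highpass_multiplier (fun m => ((m%:R : R) `^ p - 1)^-1)).
- move=> n n2; have h1 := powR_gt1 _ n2; have h2 := powR_gt1 n.+1 (leqW n2).
  rewrite lef_pV2 ?posrE ?subr_gt0// lerD2r.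
  by apply: ge0_ler_powR; rewrite ?nnegrE ?ler_nat// ltW.
- move=> n n2; apply: inv_sub1_convex; try by apply: powR_gt1; lia.
  rewrite expr2 -!powRM//; apply: ge0_ler_powR; rewrite ?nnegrE ?mulr_ge0//;
    first exact: ltW.
  by rewrite -!natrM ler_nat; lia.
- apply/cvgrPdist_le => e e0.
  have e1 : 0 <= e^-1 + 1 by rewrite addr_ge0// invr_ge0 ltW.
  pose y := (e^-1 + 1) `^ p^-1.
  have y0 : 0 <= y by exact: powR_ge0.
  exists (Num.trunc y).+2 => // n /= nn; rewrite sub0r normrN.
  have n2 : (2 <= n)%N by apply: leq_trans nn.
  have h := powR_gt1 _ n2.
  have q0 : 0 < n%:R `^ p - 1 by rewrite subr_gt0.
  rewrite ger0_norm ?invr_ge0 ?(ltW q0)// invf_ple ?posrE// lerBrDr.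
  have -> : e^-1 + 1 = y `^ p by rewrite /y -powRrM mulVf ?gt_eqF// powRr1.
  apply: ge0_ler_powR; rewrite ?nnegrE//; first exact: ltW.
  rewrite ltW// (lt_le_trans (truncnS_gt y))// ler_nat.
  exact: ltnW.
Qed.
End Power.
End Symbol.

(** * The bifurcating profile *)

Section Bifurcation.
Context {R : realType}.
Implicit Types (d e : R) (u v : R -> R).
Variables (p lam eps C : R) (r : R -> R) (K : (R -> R) -> R -> R).
Hypothesis p0 : 0 < p.
Hypothesis lam0 : 0 < lam.
Hypothesis eps0 : 0 <= eps.
Hypothesis C0 : 0 <= C.
Hypothesis K_mult :
  cosine_multiplier (fun m => if (m < 2)%N then 0 else ((m%:R : R) `^ p - 1)^-1) C K.
Hypothesis cr : continuous r.
Hypothesis r0 : r 0 = 0.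
Hypothesis r_lip : forall y z, `|y| <= 2 -> `|z| <= 2 -> `|r y - r z| <= eps * `|y - z|.
(** The map [Phi] below has Lipschitz constant at most
[eps * (7 * C + 25) / lam], which has to be at most 1/2. *)
Hypothesis eps_small : eps * (14 * C + 50) <= lam.

Let rho v x := r (cosm 1%N x + v x).
Let nu v := 2 * avg (fun x => rho v x * cosm 1%N x).
(** The multiplier with symbol [m^p / (m^p - 1)] on the modes [m >= 2]. *)
Let highpass v x :=
  v x - avg v - 2 * avg (fun y => v y * cosm 1%N y) * cosm 1%N x + K v x.
Let Phi v x := lam^-1 * (K (rho v) x - avg (rho v) - nu v * highpass v x).

Let P : set (R -> R) := [set v : R -> R | [/\ continuous v, periodic v 1,
  forall x, v (- x) = v x & bounded_by 1 v]].

Let lamV_ge0 : 0 <= lam^-1. Proof. by rewrite invr_ge0 ltW. Qed.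

Let P_bounded_continuous v : P v -> bounded_continuous v.
Proof. by case=> cv _ _ bv; split => //; exists 1. Qed.

Let cont_rho v : continuous v -> continuous (rho v).
Proof. by move=> cv; apply: cont_comp => //; apply: contD => //; exact: cont_cosm. Qed.

Let arg_le v x : P v -> `|cosm 1%N x + v x| <= 2.
Proof.
move=> [_ _ _ bv]; rewrite (le_trans (ler_normD _ _))// (_ : 2 = 1 + 1)//.
by rewrite lerD ?cosm_le1//; exact: bv.
Qed.

Let rho_lip u v d : P u -> P v -> (forall x, `|u x - v x| <= d) ->
  bounded_by (eps * d) (fun x => rho u x - rho v x).
Proof.
move=> Pu Pv uv x; apply: (le_trans (r_lip _ _ (arg_le _ x Pu) (arg_le _ x Pv))).
by rewrite ler_wpM2l// (_ : _ - _ = u x - v x)//; ring.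
Qed.

Let rho_le v : P v -> bounded_by (eps * 2) (rho v).
Proof.
move=> Pv x; have := r_lip _ 0 (arg_le _ x Pv); rewrite r0 !subr0 normr0 => H.
by rewrite (le_trans (H _))// ler_wpM2l// arg_le.
Qed.

Let rho_bounded_continuous v : P v -> bounded_continuous (rho v).
Proof.
by move=> Pv; split; [case: Pv => cv _ _ _; exact: cont_rho|exists (eps * 2);
  exact: rho_le].
Qed.

Let nu_le v : P v -> `|nu v| <= 4 * eps.
Proof.
move=> Pv; rewrite normrM (ger0_norm (_ : 0 <= 2))//.
have [cv _] := rho_bounded_continuous _ Pv;
  have := norm_coef_le _ _ 1%N cv (rho_le _ Pv); lra.
Qed.

Let nu_lip u v d : P u -> P v -> (forall x, `|u x - v x| <= d) ->
  `|nu u - nu v| <= 2 * eps * d.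
Proof.
move=> Pu Pv uv; have [cu _] := rho_bounded_continuous _ Pu;
  have [cv _] := rho_bounded_continuous _ Pv.
rewrite -mulrBr -coefB// normrM (ger0_norm (_ : 0 <= 2))//.
have := norm_coef_le _ _ 1%N (contB _ _ cu cv) (rho_lip _ _ _ Pu Pv uv); lra.
Qed.

Let highpass_le u d : continuous u -> bounded_by d u ->
  bounded_by ((4 + C) * d) (highpass u).
Proof.
move=> cu ud x; have [_ _ K3] := K_mult.
have H1 := K3 _ _ cu ud x.
have H2 := norm_avg _ _ cu ud.
have H3 := norm_coef_le _ _ 1%N cu ud.
have H4 : `|2 * avg (fun y => u y * cosm 1%N y) * cosm 1%N x| <= 2 * d.
  rewrite -[leRHS]mulr1 normrM ler_pM ?cosm_le1//.
  by rewrite normrM (ger0_norm (_ : 0 <= 2))// ler_wpM2l.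
rewrite (le_trans (ler_normD _ _))//.
rewrite (le_trans (lerD (ler_normB _ _) (lexx _)))//.
rewrite (le_trans (lerD (lerD (ler_normB _ _) (lexx _)) (lexx _)))//.
by have := ud x; lra.
Qed.

Let highpassB u v x : bounded_continuous u -> bounded_continuous v ->
  highpass u x - highpass v x = highpass (fun y => u y - v y) x.
Proof.
move=> bu bv; have [_ K2 _] := K_mult; rewrite /highpass K2//.
by have [cu _] := bu; have [cv _] := bv; rewrite coefB// avgB//; ring.
Qed.

Let P_Phi v : P v -> P (Phi v).
Proof.
move=> Pv; have bv := P_bounded_continuous _ Pv; have br := rho_bounded_continuous _ Pv.
have [cv pv ev dv] := Pv; have [cr' _] := br.
have [K1 _ K3] := K_mult.
have [cKr pKr eKr _] := K1 _ br.
have [cKv pKv eKv _] := K1 _ bv.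
have ch : continuous (highpass v).
  apply: contD => //; apply: contB.
    by apply: contB => //; exact: cont_cst.
  by apply: contZ; exact: cont_cosm.
split.
- apply: contZ; apply: contB; last exact: contZ.
  by apply: contB => //; exact: cont_cst.
- by move=> x; rewrite /Phi /highpass pKr pKv pv cosm_periodic.
- by move=> x; rewrite /Phi /highpass eKr eKv ev cosm_even.
- move=> x.
  have H1 := K3 _ _ cr' (rho_le _ Pv) x.
  have H2 := norm_avg _ _ cr' (rho_le _ Pv).
  have H3 : `|nu v * highpass v x| <= 4 * eps * (4 + C).
    rewrite normrM ler_pM ?nu_le//.
    by have := highpass_le _ _ cv dv x; rewrite mulr1.
  rewrite /Phi normrM ger0_norm ?lamV_ge0// ler_pdivrMl// mulr1.
  rewrite (le_trans (ler_normB _ _))//.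
  rewrite (le_trans (lerD (ler_normB _ _) (lexx _)))//.
  apply: le_trans eps_small; have := mulr_ge0 eps0 C0; have := eps0;
    move: H1 H2 H3; lra.
Qed.

Let Phi_contract u v d : P u -> P v -> (forall x, `|u x - v x| <= d) ->
  forall x, `|Phi u x - Phi v x| <= 2^-1 * d.
Proof.
move=> Pu Pv uv x; have bu := P_bounded_continuous _ Pu;
  have bv := P_bounded_continuous _ Pv.
have [cu _ _ _] := Pu; have [cv _ _ dv] := Pv.
have bru := rho_bounded_continuous _ Pu; have brv := rho_bounded_continuous _ Pv.
have [cru _] := bru; have [crv _] := brv.
have d0 : 0 <= d by exact: le_trans (uv 0).
have [_ K2 K3] := K_mult.
have crr := contB _ _ cru crv; have brr := rho_lip _ _ _ Pu Pv uv.
have -> : Phi u x - Phi v x = lam^-1 * (K (fun y => rho u y - rho v y) x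
   - avg (fun y => rho u y - rho v y)
   - ((nu u - nu v) * highpass v x + nu u * highpass (fun y => u y - v y) x)).
  by rewrite K2// avgB// -highpassB// /Phi; ring.
have H1 := K3 _ _ crr brr x.
have H2 := norm_avg _ _ crr brr.
have H3 : `|(nu u - nu v) * highpass v x| <= 2 * eps * d * (4 + C).
  rewrite normrM ler_pM ?nu_lip//.
  by have := highpass_le _ _ cv dv x; rewrite mulr1.
have H4 : `|nu u * highpass (fun y => u y - v y) x| <= 4 * eps * ((4 + C) * d).
  rewrite normrM ler_pM ?nu_le//.
  exact: (highpass_le _ _ (contB _ _ cu cv) uv x).
rewrite normrM ger0_norm ?lamV_ge0// ler_pdivrMl//.
rewrite (le_trans (ler_normB _ _))//.
rewrite (le_trans (lerD (ler_normB _ _) (ler_normD _ _)))//.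
have : eps * (14 * C + 50) * d <= lam * d by rewrite ler_wpM2r.
have := mulr_ge0 (mulr_ge0 eps0 C0) d0; have := mulr_ge0 eps0 d0.
lra.
Qed.

Let P_limit (V : nat -> R -> R) v : (forall n, P (V n)) ->
  (forall e, 0 < e -> exists n, forall m x, (n <= m)%N -> `|V m x - v x| <= e) -> P v.
Proof.
move=> PV Vv.
have cvgV x : V n x @[n --> \oo] --> v x.
  apply/cvgrPdist_le => e e0; have [n Hn] := Vv _ e0.
  by exists n => // m nm; rewrite distrC; exact: Hn.
split.
- apply: (uniform_limit_continuous V); first by move=> n; case: (PV n).
  by move=> e /Vv[n Hn]; exists n => x; exact: Hn.
- move=> x; rewrite -(cvg_lim _ (cvgV x))// -(cvg_lim _ (cvgV (x + 1)))//.
  suff -> : (fun n => V n (x + 1)) = (fun n => V n x) by [].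
  by apply/funext => n; case: (PV n).
- move=> x; rewrite -(cvg_lim _ (cvgV x))// -(cvg_lim _ (cvgV (- x)))//.
  suff -> : (fun n => V n (- x)) = (fun n => V n x) by [].
  by apply/funext => n; case: (PV n).
- move=> x.
  have H : `|V n x| @[n --> \oo] --> `|v x| by apply: cvg_norm; exact: cvgV.
  rewrite -(cvg_lim _ H)//; apply: limr_le; first by apply/cvg_ex; eexists; exact: H.
  by near=> n; case: (PV n).
Unshelve. all: by end_near.
Qed.

(** A profile with first mode [1/2] and the perturbation [nu] of the eigenvalue
[lam] that goes with it: the equation is the mode by mode form of
[(lam + nu) (-\partial_xx)^(p/2) w = (2 pi)^p (lam w + r(w))] on functions of
period 1. *)
Lemma bifurcating_profile : exists (w : R -> R) (nu : R),
  [/\ [/\ continuous w, periodic w 1 & forall x, w (- x) = w x],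
      `|nu| <= 4 * eps,
      avg (fun x => w x * cosm 1%N x) = 2^-1 &
      forall m, (lam + nu) * m%:R `^ p * avg (fun x => w x * cosm m x)
        = lam * avg (fun x => w x * cosm m x) + avg (fun x => r (w x) * cosm m x)].
Proof.
have P0 : P (fun=> 0).
  by split => //; [exact: cont_cst|move=> x; rewrite normr0].
have Pbound v x : P v -> `|v x| <= 1 by case=> _ _ _; exact.
have [v Pv fixv] := contraction_fixpoint _ _ _ P0 P_Phi Pbound Phi_contract P_limit.
have bv := P_bounded_continuous _ Pv; have br := rho_bounded_continuous _ Pv.
have [cv pv ev dv] := Pv; have [crv _] := br.
have cc k := @cont_cosm R k.
exists (fun x => cosm 1%N x + v x), (nu v).
have [K1 _ _] := K_mult.
have [cKr _ _ coKr] := K1 _ br.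
have [cKv _ _ coKv] := K1 _ bv.
have ch : continuous (fun x => v x - avg v).
  by apply: contB => //; exact: cont_cst.
have ch2 : continuous (fun x => 2 * avg (fun y => v y * cosm 1%N y) * cosm 1%N x).
  exact: contZ.
have coh m : avg (fun x => highpass v x * cosm m x) =
   if (m < 2)%N then 0 else (1 + (m%:R `^ p - 1)^-1) * avg (fun x => v x * cosm m x).
  have -> : avg (fun x => highpass v x * cosm m x) =
     avg (fun x => v x * cosm m x) - avg v * (m == 0)%N%:R
     - 2 * avg (fun y => v y * cosm 1%N y) * avg (fun x => cosm 1%N x * cosm m x)
     + avg (fun x => K v x * cosm m x).
    rewrite -coef_cst -coefZ// -!coefB//; last exact: cont_cst.
    rewrite -avgD; try by apply: contM => //; exact: contB.
    by congr avg; apply/funext => x; rewrite -mulrDl.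
  rewrite coKv avg_cos_cos; case: m => [|[|m]] /=.
  - by rewrite coef0; ring.
  - by field.
  - by ring.
have chp : continuous (highpass v) by apply: contD => //; exact: contB.
have cov m : lam * avg (fun x => v x * cosm m x) =
    avg (fun x => K (rho v) x * cosm m x) - avg (rho v) * (m == 0)%N%:R
    - nu v * avg (fun x => highpass v x * cosm m x).
  have cKa : continuous (fun x => K (rho v) x - avg (rho v)).
    by apply: contB => //; exact: cont_cst.
  have cnh : continuous (fun x => nu v * highpass v x) by exact: contZ.
  have ca : continuous (fun _ : R => avg (rho v)) by exact: cont_cst.
  rewrite -coef_cst -(coefZ (nu v))// -(coefZ lam)// -!coefB//.
  congr avg; apply/funext => x; congr (_ * _).
  by rewrite -[in LHS]fixv /Phi mulrA divff ?mul1r// gt_eqF.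
have cow m : avg (fun x => (cosm 1%N x + v x) * cosm m x)
   = (1 == m)%:R * 2^-1 + avg (fun x => v x * cosm m x).
  rewrite -[2^-1 in RHS]/(if 1%N == 0%N then 1 else 2^-1) -avg_cos_cos.
  rewrite -avgD; try exact: contM.
  by congr avg; apply/funext => x; rewrite mulrDl.
(* [Phi] produces functions without first mode. *)
have v1 : avg (fun x => v x * cosm 1%N x) = 0.
  have := cov 1%N; rewrite coh coKr /= !mulr0 !mul0r !subr0 => /eqP.
  by rewrite mulf_eq0 gt_eqF//= => /eqP.
split.
- split; first exact: contD.
  + by move=> x; rewrite cosm_periodic pv.
  + by move=> x; rewrite cosm_even ev.
- exact: nu_le.
- by rewrite cow v1 eqxx mul1r addr0.
- move=> m; rewrite cow.
  change (avg (fun x => r (cosm 1%N x + v x) * cosm m x))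
    with (avg (fun x => rho v x * cosm m x)).
  have := cov m; rewrite coh coKr.
  case: m => [|[|m]] /=.
  + by rewrite powR0 ?gt_eqF// !coef0; lra.
  + have -> : (1%:R : R) `^ p = 1 by rewrite powR1.
    by rewrite v1 /nu; lra.
  + set q := (m.+2%:R `^ p); have q1 : 1 < q by exact: powR_gt1.
    rewrite mulr0 subr0 mul0r add0r => H.
    have q0 : q - 1 != 0 by rewrite subr_eq0 gt_eqF.
    move: H; set A := avg _; set B := avg _; move=> H.
    have : (q - 1) * (lam * A) = (q - 1) * ((q - 1)^-1 * B - nu v * ((1 + (q -
      1)^-1) * A)).
      by rewrite H.
    have -> : (q - 1) * ((q - 1)^-1 * B - nu v * ((1 + (q - 1)^-1) * A)) = B -
      nu v * q * A.
      by field.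
    rewrite -/B => E; rewrite (_ : (lam + nu v) * q * A = lam * A + ((q - 1) *
      (lam * A) + nu v * q * A)); last by ring.
    by rewrite E; congr (_ + _); rewrite subrK.
Qed.

End Bifurcation.

(** * The reaction term near its equilibrium *)

Section Potential.
Context {R : realType}.
Implicit Types (d e : R) (F : R -> R).

Lemma derivable_cont (f : R -> R) : (forall x, derivable f x 1) -> continuous f.
Proof.
by move=> df x; apply/differentiable_continuous/derivable1_diffP/df.
Qed.

(** Monotonicity on the open half-intervals extends to [0] by continuity, so
[0] is a maximum. *)
Lemma derive1_at_interior_max F : (forall x, derivable F x 1) ->
  (forall u v : R, -1 < u -> u <= v -> v < 0 -> F u <= F v) ->
  (forall u v : R, 0 < u -> u <= v -> v < 1 -> F v <= F u) ->
  F^`() 0 = 0.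
Proof.
move=> dF Fl Fr; have cF := derivable_cont _ dF.
have Fmax t : t \in `]-1, 1[%R -> F t <= F 0.
  rewrite in_itv/= => /andP[t1 t2]; case: (ltgtP t 0) => [t0|t0|->//].
  - have H : F x @[x --> 0^'-] --> F 0 by apply: cvg_at_left_filter; exact: cF.
    rewrite -(cvg_lim _ H)//; apply: limr_ge; first by apply/cvg_ex; eexists; exact: H.
    near=> x; apply: Fl t1 _ _.
    + by near: x; exact: nbhs_left_ge.
    + by near: x; exact: nbhs_left_lt.
  - have H : F x @[x --> 0^'+] --> F 0 by apply: cvg_at_right_filter; exact: cF.
    rewrite -(cvg_lim _ H)//; apply: limr_ge; first by apply/cvg_ex; eexists; exact: H.
    near=> x; apply: Fr _ _ t2.
    + by near: x; exact: nbhs_right_gt.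
    + by near: x; exact: nbhs_right_le.
have := @derive1_at_max R F (-1) 1 0.
have N1 : -1 <= 1 :> R by lra.
have i0 : (0 : R) \in `]-1, 1[%R by rewrite in_itv/=; apply/andP; split; lra.
by move=> /(_ N1 (fun x _ => dF x) i0 Fmax) H; rewrite derive1E derive_val.
Unshelve. all: by end_near.
Qed.

(** The derivative is small near [0], and by the mean value theorem a bound for it
is a Lipschitz constant. *)
Lemma lipschitz_near0 (f : R -> R) : (forall x, derivable f x 1) ->
  continuous f^`() -> f^`() 0 = 0 ->
  forall e, 0 < e -> exists2 d, 0 < d &
    forall y z, `|y| <= d -> `|z| <= d -> `|f y - f z| <= e * `|y - z|.
Proof.
move=> df cdf f0 e e0; have cf := derivable_cont _ df.
have /cvgrPdist_le/(_ _ e0) := cdf 0.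
move=> /nbhs_ballP[d /= d0 Hd].
exists (d / 2); first by rewrite divr_gt0.
move=> y z; wlog yz : y z / y <= z.
  move=> H yd zd; case: (leP y z) => [|/ltW] yz; first exact: H.
  by rewrite distrC [`|y - z|]distrC; exact: H.
move=> yd zd.
have [c cyz fE] : exists2 c, c \in `[y, z]%R & f z - f y = derive1 f c * (z - y).
  apply: MVT_segment => //; last exact: continuous_subspaceT.
  by move=> x _; rewrite derive1E; apply: DeriveDef.
rewrite distrC [`|y - z|]distrC fE normrM ler_wpM2r//.
have := Hd c; rewrite f0 sub0r normrN; apply.
move: cyz yd zd; rewrite /ball/= sub0r normrN in_itv/= !ler_norml ltr_norml.
by move=> /andP[h1 h2] /andP[h3 h4] /andP[h5 h6]; apply/andP; split; lra.
Qed.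

End Potential.

(** * Rescaling *)

Section Rescaling.
Context {R : realType}.
Implicit Types (H w : R -> R) (T : R).

Lemma fourier_coef_even H T (m : int) : 0 < T -> continuous H -> periodic H 1 ->
  (forall x, H (- x) = H x) ->
  fourier_coef T (fun x => H (x / T)) m
  = real_complex R (avg (fun x => H x * cosm `|m|%N x)).
Proof.
move=> T0 cH pH eH; rewrite /fourier_coef.
have cl (b : R) : continuous (fun x : R => b * x) by exact: cont_scale.
have cC b : continuous (fun x => H x * cos (b * x)).
  by apply: contM => //; apply: cont_comp; [exact: continuous_cos|exact: cl].
have cS b : continuous (fun x => H x * sin (b * x)).
  by apply: contM => //; apply: cont_comp; [exact: continuous_sin|exact: cl].
have negE n x : 2 * pi * (Negz n)%:~R * x = - (2 * pi * n.+1%:R * x) :> R.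
  by rewrite NegzE mulrNz; ring.
have := avg_scale _ _ T0 (cC (2 * pi * m%:~R)).
under [X in T^-1 * X = _]eq_Rintegral do rewrite mulrA.
move=> ->.
have := avg_scale _ _ T0 (cS (2 * pi * m%:~R)).
under [X in T^-1 * X = _]eq_Rintegral do rewrite mulrA.
move=> ->.
have -> : avg (fun x => H x * sin (2 * pi * m%:~R * x)) = 0.
  case: m => n; first exact: avg_sin_even.
  have E x : H x * sin (2 * pi * (Negz n)%:~R * x) = -1 * (H x * sin (2 * pi *
    n.+1%:R * x)).
    by rewrite negE sinN; ring.
  under [X in avg X]eq_fun do rewrite E.
  by rewrite avgZ// avg_sin_even// mulr0.
rewrite oppr0; congr (Complex _ _).
congr avg; apply/funext => x; congr (_ * _); rewrite /cosm.
case: m => n //; by rewrite negE cosN.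
Qed.

(** The choice of [T] makes [|2 pi m / T|^(2s) = mu |m|^(2s)]. *)
Lemma rescaled_solution (s mu T a : R) (F w : R -> R) : 0 < s -> 0 < mu ->
  T = 2 * pi / mu `^ (2 * s)^-1 -> 0 < a ->
  continuous w -> periodic w 1 -> (forall x, w (- x) = w x) -> continuous F^`() ->
  (forall m, mu * m%:R `^ (2 * s) * avg (fun x => w x * cosm m x)
     = avg (fun x => (- derive1 F (a * w x) / a) * cosm m x)) ->
  periodic_solution s F T (fun x => a * w (x / T)).
Proof.
move=> s0 mu0 TE a0 cw pw ew cF Hm.
have pi0 := pi_gt0 R.
have q0 : 0 < mu `^ (2 * s)^-1 by exact: powR_gt0.
have qN0 : mu `^ (2 * s)^-1 != 0 by rewrite gt_eqF.
have piN0 : (pi : R) != 0 by rewrite gt_eqF.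
have T0 : 0 < T by rewrite TE divr_gt0// mulr_gt0.
have cT : continuous (fun x : R => x / T).
  by under eq_fun do rewrite mulrC; exact: cont_scale.
pose u x := a * w x; pose G x := - derive1 F (a * w x).
have cu : continuous u by exact: contZ.
have cG : continuous G.
  rewrite /G; under eq_fun do rewrite -mulN1r.
  by apply: contZ; exact: cont_comp.
have pu : periodic u 1 by move=> x; rewrite /u pw.
have pG : periodic G 1 by move=> x; rewrite /G pw.
have eu x : u (- x) = u x by rewrite /u ew.
have eG x : G (- x) = G x by rewrite /G ew.
have shift x : (x + T) / T = x / T + 1 by rewrite mulrDl divff// gt_eqF.
split.
- exact: (cont_comp u (fun x => x / T)).
- exact: (cont_comp G (fun x => x / T)).
- by move=> x; rewrite shift pw.
- by move=> x; rewrite shift pw.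
- move=> m; rewrite (fourier_coef_even u)// (fourier_coef_even G)//.
  rewrite -rmorphM; congr (real_complex R _).
  have -> : avg (fun x => G x * cosm `|m|%N x)
      = a * avg (fun x => (- derive1 F (a * w x) / a) * cosm `|m|%N x).
    rewrite -avgZ; last first.
      apply: contM; last exact: cont_cosm.
      by under eq_fun do rewrite mulrC; exact: contZ.
    by congr avg; apply/funext => x; rewrite /G mulrA mulrCA divff ?mulr1// gt_eqF.
  rewrite -Hm /u coefZ// [RHS]mulrCA; congr (_ * (_ * _)).
  have -> : 2 * pi * m%:~R / T = m%:~R * mu `^ (2 * s)^-1.
    have H (x y z : R) : x != 0 -> y != 0 -> 2 * x * z / (2 * x / y) = z * y.
      by move=> xN0 yN0; field; rewrite xN0 yN0.
    by rewrite TE H.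
  rewrite normrM (ger0_norm (ltW q0)) powRM//; last exact: ltW.
  rewrite -powRrM mulVf ?gt_eqF ?mulr_gt0// powRr1 1?ltW// mulrC.
  by rewrite -intr_norm -abszE.
Qed.

End Rescaling.

(** * Nonconstant solutions with periods close to the bound *)

Section PeriodBelow.
Context {R : realType}.
Implicit Types (T d e : R).

(** Stated with an arbitrary lower bound [mu0 < - F''(0)] for [mu] instead of a
limit: a bound for the period then needs only the monotonicity of powers. *)
Lemma nonconstant_solution (s : R) (F : R -> R) (mu0 : R) : 0 < s ->
  smooth F -> derive1 F 0 = 0 -> 0 < mu0 -> mu0 < - derive1n 2 F 0 ->
  exists mu T u, [/\ mu0 <= mu, T = 2 * pi / mu `^ (2 * s)^-1,
    nonconstant u & periodic_solution s F T u].
Proof.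
move=> s0 F_smooth dF0 mu00 mulam.
set lam : R := - derive1n 2 F 0 in mulam.
have lam0 : 0 < lam by lra.
have p0 : 0 < 2 * s by rewrite mulr_gt0.
have dF1 x : derivable (derive1 F) x 1 := F_smooth 1%N x.
have dF2 x : derivable (derive1n 2 F) x 1 := F_smooth 2%N x.
have cF1 := derivable_cont _ dF1.
have cF2 := derivable_cont _ dF2.
have [K [C [C0 K_mult]]] := power_symbol_multiplier _ p0.
pose r (z : R) : R := - derive1 F z - lam * z.
have Cp : 0 < 14 * C + 50 by lra.
pose e : R := Num.min ((lam - mu0) / 4) (lam / (14 * C + 50)).
have e0 : 0 < e by rewrite /e lt_min !divr_gt0//; lra.
have e1 : 4 * e <= lam - mu0.
  by have : e <= (lam - mu0) / 4; [rewrite /e ge_min lexx|lra].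
have e2 : e * (14 * C + 50) <= lam.
  by rewrite -ler_pdivlMr// /e ge_min lexx orbT.
have dr (x : R) : is_derive x 1 r (- derive1n 2 F x - lam).
  have -> : r = - derive1 F - lam \*: id by apply/funext.
  have dF : is_derive x 1 (derive1 F) (derive1n 2 F x).
    by rewrite /= derive1E; apply: DeriveDef.
  apply: is_derive_eq.
  by rewrite /GRing.scale/= mulr1.
have dr' (x : R) : derivable r x 1 by case: (dr x).
have r1 : derive1 r = fun x => - derive1n 2 F x - lam.
  by apply/funext => x; rewrite derive1E; apply: derive_val.
have cr := derivable_cont _ dr'.
have cr1 : continuous (derive1 r).
  rewrite r1; apply: contB; last exact: cont_cst.
  by move=> x; apply: continuousN; exact: cF2.
have r10 : derive1 r 0 = 0 by rewrite r1; exact: subrr.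
have [d d0 Hd] := lipschitz_near0 _ dr' cr1 r10 _ e0.
(* [ra] is evaluated at arguments bounded by 2. *)
pose a := d / 2.
have a0 : 0 < a by rewrite divr_gt0.
have aN0 : a != 0 by rewrite gt_eqF.
pose ra w := r (a * w) / a.
have cra : continuous ra.
  rewrite /ra; under eq_fun do rewrite mulrC.
  by apply: contZ; apply: cont_comp => //; exact: cont_scale.
have ra0 : ra 0 = 0 by rewrite /ra /r mulr0 dF0 mulr0 oppr0 addr0 mul0r.
have ra_lip y z : `|y| <= 2 -> `|z| <= 2 -> `|ra y - ra z| <= e * `|y - z|.
  move=> y2 z2.
  have aD t : `|t| <= 2 -> `|a * t| <= d.
    move=> t2; rewrite normrM gtr0_norm// (_ : d = a * 2); last by rewrite /a; field.
    by rewrite ler_wpM2l// ltW.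
  rewrite /ra -mulrBl normrM (@gtr0_norm _ a^-1) ?invr_gt0//.
  rewrite ler_pdivrMr// (le_trans (Hd _ _ (aD _ y2) (aD _ z2)))//.
  by rewrite -mulrBr normrM (gtr0_norm a0) [a * _]mulrC mulrA.
have [w [nu [[cw pw ew] nule w1 Hw]]] :=
  bifurcating_profile _ _ _ _ _ _ p0 lam0 (ltW e0) C0 K_mult cra ra0 ra_lip e2.
have munu : mu0 <= lam + nu by move: nule; rewrite ler_norml => /andP[]; lra.
have mupos : 0 < lam + nu by lra.
exists (lam + nu), (2 * pi / (lam + nu) `^ (2 * s)^-1),
  (fun x => a * w (x / (2 * pi / (lam + nu) `^ (2 * s)^-1))).
set T := 2 * pi / _.
have T0 : 0 < T by rewrite divr_gt0 ?mulr_gt0 ?pi_gt0// powR_gt0.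
split => //.
- move=> [c Hc].
  have wc x : w x = c / a.
    by rewrite -(Hc (x * T)) mulfK ?gt_eqF// mulrC mulKf.
  (* The first mode of [w] is not zero, unlike that of a constant. *)
  move: w1; rewrite (_ : (fun x => w x * cosm 1%N x) = fun x => c / a * cosm 1%N x).
    by rewrite coef_cst mulr0; lra.
  by apply/funext => x; rewrite wc.
- apply: (@rescaled_solution _ _ (lam + nu)) => //.
  move=> m; rewrite Hw -coefZ// -avgD.
  + congr avg; apply/funext => x; rewrite -mulrDl; congr (_ * _).
    by rewrite /ra /r; field.
  + by apply: contM; [exact: contZ|exact: cont_cosm].
  + by apply: contM; [exact: cont_comp|exact: cont_cosm].
Qed.

End PeriodBelow.

Theorem theorem3p2 (R : realType) (s : R) (F : R -> R)
  (s_gt0 : 0 < s) (s_lt1 : s < 1)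
  (F_smooth : smooth F)
  (F_at_1 : F 1 = 0) (F_at_N1 : F (-1) = 0)
  (F_pos : forall u : R, -1 < u -> u < 1 -> 0 < F u)
  (dF_at_1 : F^`() 1 = 0) (dF_at_N1 : F^`() (-1) = 0)
  (F_nondecreasing : forall u v : R,
     -1 < u -> u <= v -> v < 0 -> F u <= F v)
  (F_nonincreasing : forall u v : R,
     0 < u -> u <= v -> v < 1 -> F v <= F u)
  (d2F_at_0 : F^`(2) 0 < 0) :
  (T0 s F <= (2 * pi * (1 / (- (F^`(2) 0)%classic)) `^ (1 / (2 * s)))%:E)%E.
Proof.
have dF0 : derive1 F 0 = 0.
  by apply: derive1_at_interior_max => // x; exact: (F_smooth 0%N).
set lam : R := - derive1n 2 F 0.
have lam0 : 0 < lam by rewrite oppr_gt0.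
have p0 : 0 < 2 * s by rewrite mulr_gt0.
have pi0 := pi_gt0 R.
set q : R := (2 * s)^-1.
have q0 : 0 < q by rewrite invr_gt0.
rewrite !div1r -/q.
have lamVq : (lam^-1) `^ q = (lam `^ q)^-1.
  have lq : lam `^ q != 0 by rewrite gt_eqF// powR_gt0.
  apply: (mulIf lq); rewrite mulVf// -powRM ?invr_ge0 ?(ltW lam0)//.
  by rewrite mulVf ?powR1// gt_eqF.
apply/lee_addgt0Pr => e e0; rewrite -EFinD.
set T' := _ + e.
have Tstar : T' = 2 * pi / lam `^ q + e by rewrite /T' lamVq.
have lq0 : 0 < lam `^ q by exact: powR_gt0.
have T'0 : 0 < T' by rewrite Tstar addr_gt0// divr_gt0// mulr_gt0.
(* The eigenvalue for which the period is [T']. *)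
pose mu0 : R := (2 * pi / T') `^ (2 * s).
have b0 : 0 < 2 * pi / T' by rewrite divr_gt0// mulr_gt0.
have mu00 : 0 < mu0 by exact: powR_gt0.
have mu0q : mu0 `^ q = 2 * pi / T'.
  by rewrite /mu0 -powRrM mulfV ?gt_eqF// powRr1// ltW.
have mu0lam : mu0 < lam.
  have -> : lam = (lam `^ q) `^ (2 * s).
    by rewrite -powRrM mulVf ?gt_eqF// powRr1// ltW.
  apply: gt0_ltr_powR => //; rewrite ?nnegrE ?ltW//.
  by rewrite ltr_pdivrMr// [_ * T']mulrC -ltr_pdivrMr// Tstar ltrDl.
have [mu [T [u [mu0mu TE uN uS]]]] := nonconstant_solution _ _ _ s_gt0 F_smooth
  dF0 mu00 mu0lam.
have mupos : 0 < mu by apply: lt_le_trans mu0mu.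
have muq0 : 0 < mu `^ q by exact: powR_gt0.
have T0 : 0 < T by rewrite TE divr_gt0// mulr_gt0.
apply: (@le_trans _ _ T%:E).
  by apply: ereal_inf_lbound; exists T => //; split=> //; exists u.
rewrite lee_fin TE ler_pdivrMr// [T' * _]mulrC -ler_pdivrMr// -mu0q.
by apply: ge0_ler_powR; rewrite ?nnegrE// ltW.
Qed.
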